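(* Let $s_1\ge s_2\ge1$ be coprime integers. Every $(s_1,s_2)$-quasi-homogeneous planar foliation $$P(x,y)\,dy-Q(x,y)\,dx=0$$ ($P,Q$ real polynomials) is the pull-back of a homogeneous planar foliation $$P^*(x,y)\,dy-Q^*(x,y)\,dx=0,$$ where $P^*,Q^*$ are homogeneous polynomials of the same degree, under the map $(x,y)\mapsto(x^{s_2},y^{s_1})$.
   Context: The planar foliation $P\,dy-Q\,dx=0$ is $(s_1,s_2)$-quasi-homogeneous if it is invariant under all maps $(x,y)\mapsto(\lambda^{s_1}x,\lambda^{s_2}y)$, $\lambda>0$; equivalently $P(\lambda^{s_1}x,\lambda^{s_2}y)=\lambda^{d_1}P(x,y)$ and $Q(\lambda^{s_1}x,\lambda^{s_2}y)=\lambda^{d_2}Q(x,y)$ for suitable $d_1,d_2$ with $d_2+s_1=d_1+s_2$. A foliation depends only on its defining one-form up to multiplication by a non-zero (rational) function; the foliation $\omega=0$ is the pull-back of $\omega^*=0$ under a map $\phi$ if $\phi^*\omega^*$ is a multiple of $\omega$ by a non-zero rational function. *)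

(* Defs.v *)
From HB Require Import structures.
From mathcomp Require Import all_boot all_order all_algebra fraction.
From mathcomp Require Import reals.
From mathcomp Require Import mpoly.

Set Implicit Arguments.
Unset Strict Implicit.
Unset Printing Implicit Defensive.

Import Order.TTheory GRing.Theory Num.Theory.
Local Open Scope ring_scope.

Section PlanarFoliations.
Variable R : realType.

Definition pol := {mpoly R[2]}.

Definition ratfun := {fraction pol}.

Definition varx : pol := 'X_(ord0 : 'I_2).
Definition vary : pol := 'X_(ord_max : 'I_2).

(* The pair (A, B) stands for the one-form A dx + B dy. *)
Definition one_form := (pol * pol)%type.

(* P dy - Q dx *)
Definition form_of (P Q : pol) : one_form := (- Q, P).

(* The zero one-form defines no foliation. *)
Definition defines_foliation (w : one_form) : Prop := w <> (0, 0).

(* The pair (f, g) stands for the map (x, y) |-> (f(x, y), g(x, y)). *)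
Definition plane_map := (pol * pol)%type.

Definition pullback_fun (phi : plane_map) (p : pol) : pol :=
  p \mPo [tuple phi.1; phi.2].

(* phi^*(A dx + B dy) = (A o phi) df + (B o phi) dg, where phi = (f, g) *)
Definition pullback_form (phi : plane_map) (w : one_form) : one_form :=
  let A := pullback_fun phi w.1 in
  let B := pullback_fun phi w.2 in
  (A * phi.1^`M(ord0) + B * phi.2^`M(ord0),
   A * phi.1^`M(ord_max) + B * phi.2^`M(ord_max)).

Definition rational_multiple (w' w : one_form) : Prop :=
  exists h : ratfun,
    [/\ h != 0, tofrac w'.1 = h * tofrac w.1 & tofrac w'.2 = h * tofrac w.2].

(* The foliation w = 0 is the pull-back of w' = 0 under phi. *)
Definition is_pullback (phi : plane_map) (w' w : one_form) : Prop :=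
  rational_multiple (pullback_form phi w') w.

Definition dilation (s1 s2 : nat) (l : R) : plane_map :=
  (l ^+ s1 *: varx, l ^+ s2 *: vary).

(* Invariance is that of the foliation, so it does not depend on the choice of
   the defining one-form; no coprimality of P and Q is needed. *)
Definition quasi_homogeneous (s1 s2 : nat) (w : one_form) : Prop :=
  forall l : R, 0 < l -> is_pullback (dilation s1 s2 l) w w.

Definition power_map (m n : nat) : plane_map := (varx ^+ m, vary ^+ n).

(* The integers d1, d2 may be negative: this happens when Q = 0 and s1 > s2. *)
Lemma quasi_homogeneous_of_weights (s1 s2 : nat) (d1 d2 : int) (P Q : pol) :
  (forall l : R, 0 < l ->
     pullback_fun (dilation s1 s2 l) P = l ^ d1 *: P) ->
  (forall l : R, 0 < l ->
     pullback_fun (dilation s1 s2 l) Q = l ^ d2 *: Q) ->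
  d2 + s1%:Z = d1 + s2%:Z ->
  quasi_homogeneous s1 s2 (form_of P Q).
Proof.
move=> hP hQ hd l l0; have ln0 : l != 0 by rewrite gt_eqF.
have dX i j : ('X_j : pol)^`M(i) = (j == i)%:R.
  rewrite mderivX mnm1E; case: eqP => [->|_]; last by rewrite scale0r.
  have ->: (U_(i) - U_(i) = 0 :> 'X_{1..2})%MM by apply/mnmP=> k; rewrite mnmBE subnn mnm0E.
  by rewrite mpolyX0 scale1r.
exists (tofrac ((l ^ (d1 + s2%:Z))%:MP)); rewrite -!tofracM; split.
- by rewrite tofrac_eq0 mpolyC_eq0 expfz_neq0.
- rewrite /= /pullback_fun comp_mpolyN [comp_mpoly _ Q]hQ // !mderivZ !dX /=.
  rewrite scaler0 mulr0 addr0 mul_mpolyC -hd expfzDr // -exprnP scalerN.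
  by rewrite -scalerAr mulr1 scalerN scalerA mulrC.
- rewrite /= /pullback_fun comp_mpolyN [comp_mpoly _ P]hP // !mderivZ !dX /=.
  rewrite scaler0 mulr0 add0r mul_mpolyC expfzDr // -exprnP.
  by rewrite -scalerAr mulr1 scalerA mulrC.
Qed.

End PlanarFoliations.

(* Main.v *)
(** Write the form as [A dx + B dy]. Invariance says that the pair [(x A, y B)]
    is parallel to its dilation by every [l > 0]; comparing powers of [l], it is
    parallel to the pair of its components of any given weight [K]. Since [s1]
    and [s2] are coprime, the exponents of the monomials of weight [K] lie in
    one class modulo [s2] (for [x]) and one modulo [s1] (for [y]), so both
    components equal a common monomial times a homogeneous polynomial in
    [(x^s2, y^s1)], of the same degree for both. *)
From HB Require Import structures.
Require Import Defs.
From mathcomp Require Import all_boot all_order all_algebra fraction.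
From mathcomp Require Import reals.
From mathcomp Require Import mpoly.
From mathcomp Require Import ring.

Local Open Scope ring_scope.

Set Implicit Arguments.
Unset Strict Implicit.
Unset Printing Implicit Defensive.

Import Order.TTheory GRing.Theory Num.Theory.

(** * Weights of monomials and the arithmetic of their exponents *)

Definition wdeg (s1 s2 : nat) (m : 'X_{1..2}) : nat :=
  (s1 * m ord0 + s2 * m ord_max)%N.

Lemma wdeg0 s1 s2 : wdeg s1 s2 0%MM = 0%N.
Proof. by rewrite /wdeg !mnm0E !muln0. Qed.

Lemma wdegD s1 s2 : {morph wdeg s1 s2 : m1 m2 / (m1 + m2)%MM >-> (m1 + m2)%N}.
Proof. by move=> m1 m2; rewrite /wdeg !mnmDE !mulnDr addnACA. Qed.

HB.instance Definition _ s1 s2 :=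
  isMeasure.Build 2 (wdeg s1 s2) (wdeg0 s1 s2) (@wdegD s1 s2).

(** The difference of the two sides shows that [s2] divides [s1 * (a - a')], and [s2] is coprime to
    [s1]. *)
Lemma eqn_lin_mod_coprime (s1 s2 a b a' b' : nat) : coprime s1 s2 ->
  (s1 * a + s2 * b = s1 * a' + s2 * b')%N -> (a %% s2 = a' %% s2)%N.
Proof.
move=> cop e; apply/eqP.
wlog le_aa : a b a' b' e / (a' <= a)%N.
  move=> th; case: (leqP a' a) => [le|/ltnW le]; first exact: (th _ _ _ _ e).
  by rewrite eq_sym; apply: (th _ _ _ _ (esym e)).
rewrite eqn_mod_dvd // -(@Gauss_dvdr s2 s1) 1?coprime_sym // mulnBr.
have -> : (s1 * a - s1 * a' = s2 * b' - s2 * b)%N.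
  by rewrite -(subnDr (s2 * b)) e addnC subnDA addnK.
by rewrite -mulnBr dvdn_mulr.
Qed.

(** Division with remainder splits a weight into [s1 * s2] times the sum of the quotients plus a
    part that depends on the remainders only, and these agree. The sum of the quotients becomes the
    common degree. *)
Lemma eqn_lin_div_coprime (s1 s2 a b a' b' : nat) :
  (0 < s1)%N -> (0 < s2)%N -> coprime s1 s2 ->
  (s1 * a + s2 * b = s1 * a' + s2 * b')%N ->
  (a %/ s2 + b %/ s1 = a' %/ s2 + b' %/ s1)%N.
Proof.
move=> s1_gt0 s2_gt0 cop e.
have ea : (a %% s2 = a' %% s2)%N by apply: eqn_lin_mod_coprime e.
have eb : (b %% s1 = b' %% s1)%N.
  by apply: (@eqn_lin_mod_coprime s2 s1 b a b' a'); rewrite 1?coprime_sym // addnC e addnC.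
apply/eqP; rewrite -(@eqn_pmul2l (s1 * s2)) ?muln_gt0 ?s1_gt0 //.
rewrite -(eqn_add2r (s1 * (a %% s2) + s2 * (b %% s1))) {2}ea {2}eb.
have splitE u v : (s1 * s2 * (u %/ s2 + v %/ s1) + (s1 * (u %% s2) + s2 * (v %% s1))
    = s1 * u + s2 * v)%N.
  rewrite [in RHS](divn_eq u s2) [in RHS](divn_eq v s1); ring.
by rewrite !splitE e.
Qed.

Lemma mulr_regroup (K : comNzRingType) (a b u v z : K) :
  a * (u * (b * v * z)) = b * a * (u * v) * z.
Proof. ring. Qed.

(** * Pull-backs of polynomials and one-forms, and weight components *)

Section Pullbacks.
Variable R : realType.
Implicit Types (p q A B : pol R) (l : R) (m : 'X_{1..2}).

Let x := varx R.
Let y := vary R.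

Lemma mpolyX2E m : 'X_[m] = x ^+ m ord0 * y ^+ m ord_max :> pol R.
Proof. by rewrite mpolyXE_id big_ord_recl big_ord1; congr (_ * 'X_ _ ^+ m _); apply/val_inj. Qed.

Lemma pullback_fun_linear (phi : plane_map R) : linear (pullback_fun phi).
Proof. by move=> c p q; rewrite /pullback_fun comp_mpolyD comp_mpolyZ. Qed.

HB.instance Definition _ phi := GRing.isLinear.Build R (pol R) (pol R) _
  (pullback_fun phi) (pullback_fun_linear phi).

Lemma pullback_fun_monoid_morphism (phi : plane_map R) :
  monoid_morphism (pullback_fun phi).
Proof. exact: (rmorphism_monoidP (comp_mpoly [tuple phi.1; phi.2])). Qed.

HB.instance Definition _ phi := GRing.isMonoidMorphism.Build (pol R) (pol R)
  (pullback_fun phi) (pullback_fun_monoid_morphism phi).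

Lemma pullback_fun_x (phi : plane_map R) : pullback_fun phi x = phi.1.
Proof. by rewrite /pullback_fun comp_mpolyXU. Qed.

Lemma pullback_fun_y (phi : plane_map R) : pullback_fun phi y = phi.2.
Proof. by rewrite /pullback_fun comp_mpolyXU. Qed.

Lemma pullback_funX (phi : plane_map R) m :
  pullback_fun phi 'X_[m] = phi.1 ^+ m ord0 * phi.2 ^+ m ord_max.
Proof. by rewrite mpolyX2E rmorphM !rmorphXn /= pullback_fun_x pullback_fun_y. Qed.

Lemma dhomog_varXn (i : 'I_2) n : ('X_i ^+ n : pol R) \is n.-homog.
Proof.
have h : ('X_i : pol R) \is 1.-homog by rewrite dhomogX; apply/eqP/mdeg1.
by have := dhomogMn n h; rewrite mul1n.
Qed.

(** The factor ['X_i] restores the exponent lowered by differentiation, so the formula also covers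
    exponent 0. *)
Lemma euler_mpolyX (i : 'I_2) m :
  'X_i * ('X_[m] : pol R)^`M(i) = (m i)%:R *: 'X_[m].
Proof.
rewrite mderivX -scalerAr; case: (posnP (m i)) => [->|mi_gt0].
  by rewrite !scale0r.
by rewrite -mpolyXD addmC submK // lep1mP -lt0n.
Qed.

Lemma euler_mpolyXn (i j : 'I_2) n :
  'X_i * ('X_j ^+ n : pol R)^`M(i) = (n * (j == i))%:R *: 'X_j ^+ n.
Proof. by rewrite mpolyXn euler_mpolyX mulmnE mnm1E mulnC. Qed.

Lemma pullback_fun_dilation_homog s1 s2 d l p :
  p \is d.-homog for (wdeg s1 s2) ->
  pullback_fun (dilation s1 s2 l) p = l ^+ d *: p.
Proof.
move=> /dhomogP hp; rewrite [in LHS](mpolyE p) [in RHS](mpolyE p).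
rewrite raddf_sum scaler_sumr /= big_seq [RHS]big_seq; apply: eq_bigr => m mp.
rewrite linearZ /= scalerA mulrC -scalerA; congr (_ *: _); rewrite pullback_funX /dilation /=.
rewrite !exprZn -!exprM -scalerAl -scalerAr scalerA -exprD mpolyX2E.
by rewrite -(hp m mp).
Qed.

(** The factor is [A' / A], or [B' / B] when [A = 0]; the search for it thus reduces to a polynomial
    identity. *)
Lemma rational_multiple_of_cross (w' w : one_form R) :
  w' <> (0, 0) -> w <> (0, 0) -> w'.1 * w.2 = w'.2 * w.1 ->
  rational_multiple w' w.
Proof.
case: w' w => [A' B'] [A B] /= n' n e.
have e' : tofrac A' * tofrac B = tofrac B' * tofrac A by rewrite -!tofracM e.
have [A0|A0] := eqVneq A 0.
  have B0 : B != 0 by apply/eqP => B0; apply: n; rewrite A0 B0.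
  move: e; rewrite A0 mulr0 => /eqP; rewrite mulf_eq0 (negbTE B0) orbF => /eqP A'0.
  have B'0 : B' != 0 by apply/eqP => B'0; apply: n'; rewrite A'0 B'0.
  exists (tofrac B' / tofrac B); rewrite mulf_neq0 ?invr_neq0 ?tofrac_eq0 //=.
  by rewrite A'0 tofrac0 mulr0 divfK ?tofrac_eq0.
have A'0 : A' != 0.
  apply/eqP => A'0; apply: n'; move: e; rewrite A'0 mul0r => /esym/eqP.
  by rewrite mulf_eq0 (negbTE A0) orbF => /eqP->.
exists (tofrac A' / tofrac A); rewrite mulf_neq0 ?invr_neq0 ?tofrac_eq0 //=.
by rewrite divfK ?tofrac_eq0 // mulrAC e' mulfK ?tofrac_eq0.
Qed.

Lemma cross_of_rational_multiple (w' w : one_form R) :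
  rational_multiple w' w -> w'.1 * w.2 = w'.2 * w.1.
Proof.
case=> h [_ e1 e2]; apply/eqP; rewrite -tofrac_eq.
by rewrite !tofracM e1 e2 mulrAC.
Qed.

(** [x * A] and [y * B] are the coefficients in the basis dx/x, dy/y, which dilations leave
    invariant. *)
Lemma pullback_form_dilation s1 s2 l A B :
  let phi := dilation s1 s2 l in
  (x * (pullback_form phi (A, B)).1 = pullback_fun phi (x * A)) *
  (y * (pullback_form phi (A, B)).2 = pullback_fun phi (y * B)).
Proof.
move=> phi; rewrite /pullback_form /= !mderivZ !rmorphM /=.
rewrite pullback_fun_x pullback_fun_y /= !mulrDr !(mulrCA x) !(mulrCA y).
rewrite -!scalerAr -[varx R]expr1 -[vary R]expr1 !euler_mpolyXn /= !scale0r.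
by rewrite ?mulr0 !scaler0 addr0 add0r !scale1r -!scalerAl !expr1 !(mulrC (pullback_fun _ _)).
Qed.

(** The power map multiplies dx/x by [a] and dy/y by [b]. *)
Lemma pullback_form_power_map a b A B :
  let phi := power_map R a b in
  (x * (pullback_form phi (A, B)).1 = a%:R * pullback_fun phi (x * A)) *
  (y * (pullback_form phi (A, B)).2 = b%:R * pullback_fun phi (y * B)).
Proof.
move=> phi; rewrite /pullback_form /= !rmorphM /=.
rewrite pullback_fun_x pullback_fun_y /= !mulrDr !(mulrCA x) !(mulrCA y).
rewrite !euler_mpolyXn /= !muln0 !scale0r !muln1 !mulr0 addr0 add0r.
by rewrite !scaler_nat !mulrnAr !mulr_natl !(mulrC (pullback_fun _ _)).
Qed.

(* The difference of both sides, expanded in weight components, is a polynomial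
   in [l] vanishing at all [l > 0]. *)
Lemma cross_pihomog s1 s2 A B :
  (forall l, 0 < l ->
     pullback_fun (dilation s1 s2 l) A * B =
     pullback_fun (dilation s1 s2 l) B * A) ->
  forall k, pihomog (wdeg s1 s2) k A * B = pihomog (wdeg s1 s2) k B * A.
Proof.
move=> hl k; apply/eqP; rewrite -subr_eq0; apply/eqP/mpolyP => m; rewrite mcoeff0.
pose W k := pihomog (wdeg s1 s2) k A * B - pihomog (wdeg s1 s2) k B * A.
(* The entry [k.+1] keeps [k] in range even beyond the weights of [A] and [B]. *)
pose N := maxn k.+1 (maxn (mmeasure (wdeg s1 s2) A) (mmeasure (wdeg s1 s2) B)).
have NA : (mmeasure (wdeg s1 s2) A <= N)%N by rewrite /N !leq_max leqnn orbT.
have NB : (mmeasure (wdeg s1 s2) B <= N)%N by rewrite /N !leq_max leqnn !orbT.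
have dil p l : (mmeasure (wdeg s1 s2) p <= N)%N ->
    pullback_fun (dilation s1 s2 l) p = \sum_(i < N) l ^+ i *: pihomog (wdeg s1 s2) i p.
  move=> Np; rewrite [in LHS](pihomog_partitionE Np) raddf_sum /=; apply: eq_bigr => i _.
  exact/pullback_fun_dilation_homog/pihomogP.
pose w := \poly_(i < N) (W i)@_m.
have w0 l : 0 < l -> root w l.
  move=> /hl /eqP; rewrite -subr_eq0 !dil // !mulr_suml -sumrB => /eqP sum0.
  rewrite rootE horner_poly; apply/eqP.
  move: (congr1 (mcoeff m) sum0); rewrite mcoeff0 raddf_sum /= => sum0m.
  rewrite -[RHS]sum0m; apply: eq_bigr => i _.
  by rewrite -!scalerAl -scalerBr mcoeffZ mulrC.
have w_eq0 : w = 0.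
  (* The integers from 1 to [size w] are more roots than the degree allows. *)
  apply: (@roots_geq_poly_eq0 _ w [seq i.+1%:R | i <- iota 0 (size w)]).
  - by apply/allP => z /mapP[i _ ->]; rewrite w0 ?ltr0Sn.
  - by rewrite map_inj_uniq ?iota_uniq // => i j /eqP; rewrite eqr_nat eqSS => /eqP.
  - by rewrite size_map size_iota.
by move/polyP: w_eq0 => /(_ k); rewrite coef0 coef_poly ifT // /N leq_max ltnSn.
Qed.

(** Some component is non-zero, and its leading monomial is [m]. Having the weight as that of a
    monomial provides the exponents to divide in [homog_power_mapE]. *)
Lemma pihomog_wdeg_neq0 s1 s2 p :
  p != 0 -> exists m, pihomog (wdeg s1 s2) (wdeg s1 s2 m) p != 0.
Proof.
have [/existsP[i pi0] _|/existsPn h] :=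
    boolP [exists i : 'I_(mmeasure (wdeg s1 s2) p), pihomog (wdeg s1 s2) i p != 0].
  exists (mlead (pihomog (wdeg s1 s2) i p)).
  by rewrite (dhomogP _ _ _ (pihomogP _ _ _) _ (mlead_supp pi0)).
rewrite (pihomog_partitionE (leqnn (mmeasure (wdeg s1 s2) p))) big1 ?eqxx // => i _.
exact/eqP/negbNE.
Qed.

Lemma homog_power_mapE s1 s2 m p :
  (0 < s1)%N -> (0 < s2)%N -> coprime s1 s2 ->
  p \is (wdeg s1 s2 m).-homog for (wdeg s1 s2) ->
  exists2 q : pol R, q \is (m ord0 %/ s2 + m ord_max %/ s1).-homog &
    p = x ^+ (m ord0 %% s2) * y ^+ (m ord_max %% s1)
        * pullback_fun (power_map R s2 s1) q.
Proof.
move=> s1_gt0 s2_gt0 cop /dhomogP hp.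
(* Each exponent is replaced by its quotient; the remainders are those of [m] and factor out. *)
exists (\sum_(n <- msupp p)
    p@_n *: (x ^+ (n ord0 %/ s2) * y ^+ (n ord_max %/ s1))).
  rewrite big_seq; apply: rpred_sum => n np; apply: rpredZ.
  rewrite -(eqn_lin_div_coprime s1_gt0 s2_gt0 cop (hp n np)).
  by apply: dhomogM; apply: dhomog_varXn.
rewrite {1}(mpolyE p) raddf_sum mulr_sumr /= big_seq [RHS]big_seq.
apply: eq_bigr => n np; rewrite linearZ /= -scalerAr; congr (_ *: _).
have e : (s1 * n ord0 + s2 * n ord_max = s1 * m ord0 + s2 * m ord_max)%N := hp n np.
rewrite -(eqn_lin_mod_coprime cop e).
have e' : (s2 * n ord_max + s1 * n ord0 = s2 * m ord_max + s1 * m ord0)%N.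
  by rewrite addnC e addnC.
rewrite coprime_sym in cop; rewrite -(eqn_lin_mod_coprime cop e').
rewrite rmorphM !rmorphXn /= pullback_fun_x pullback_fun_y /= -!exprM.
rewrite mulrACA -!exprD mpolyX2E.
by rewrite ![(_ * (_ %/ _))%N]mulnC ![(_ %% _ + _)%N]addnC -!divn_eq.
Qed.

End Pullbacks.

Theorem theorem2p5 (R : realType) (s1 s2 : nat)
    (hs2 : (1 <= s2)%N) (hs12 : (s2 <= s1)%N) (hcop : coprime s1 s2)
    (P Q : {mpoly R[2]})
    (hfol : defines_foliation (form_of P Q))
    (hqh : quasi_homogeneous s1 s2 (form_of P Q)) :
  exists (d : nat) (Ps Qs : {mpoly R[2]}),
    [/\ Ps \is d.-homog, Qs \is d.-homog,
        defines_foliation (form_of Ps Qs)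
      & is_pullback (power_map R s2 s1) (form_of Ps Qs) (form_of P Q)].
Proof.
have s2_gt0 := hs2; have s1_gt0 : (0 < s1)%N := leq_trans hs2 hs12.
set x := varx R; set y := vary R; set phi := power_map R s2 s1.
have x0 : x != 0 by rewrite -msupp_eq0 msuppX.
have y0 : y != 0 by rewrite -msupp_eq0 msuppX.
(* Coefficients of the form in the basis dx/x, dy/y. *)
set U := x * - Q; set V := y * P.
have UV0 : (U != 0) || (V != 0).
  rewrite /U /V !mulf_eq0 (negbTE x0) (negbTE y0) /= -negb_and.
  by apply/negP => /andP[/eqP Q0 /eqP P0]; apply: hfol; rewrite /form_of Q0 P0.
have cross : forall k, pihomog (wdeg s1 s2) k U * V = pihomog (wdeg s1 s2) k V * U.
  apply: cross_pihomog => l /hqh /cross_of_rational_multiple e.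
  have [EU EV] := pullback_form_dilation s1 s2 l (- Q) P.
  by rewrite /U /V -/x -/y -EU -EV mulrACA [RHS]mulrACA (mulrC y); congr (_ * _).
have [m Wm] : exists m, (pihomog (wdeg s1 s2) (wdeg s1 s2 m) U != 0)
    || (pihomog (wdeg s1 s2) (wdeg s1 s2 m) V != 0).
  by case/orP: UV0 => /(pihomog_wdeg_neq0 s1 s2)[m hm]; exists m; rewrite hm ?orbT.
have /(homog_power_mapE s1_gt0 s2_gt0 hcop)[q hq eU] := pihomogP (wdeg s1 s2) (wdeg s1 s2 m) U.
have /(homog_power_mapE s1_gt0 s2_gt0 hcop)[r hr eV] := pihomogP (wdeg s1 s2) (wdeg s1 s2 m) V.
move: (cross (wdeg s1 s2 m)) Wm; rewrite {}eU {}eV -/x -/y -/phi.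
(* Both components are compared with the same [m], hence share the monomial [M] and the degree
   [d]. *)
set M := _ * _ ^+ _; set d := (_ + _)%N in hq hr *.
have M0 : M != 0 by rewrite mulf_neq0 ?expf_neq0.
rewrite !(mulf_eq0 M) (negbTE M0) -!(mulrA M) => /(mulfI M0) qVrU qr0.
(* In the basis dx/x, dy/y this form has coefficients [s1 * x * y * q] and [s2 * x * y * r]. The
   constants offset the factors [s2] and [s1] produced by the power map, so both pulled-back
   coefficients carry the same factor [c]. *)
exists d.+1, (s2%:R * x * r), (- (s1%:R * y * q)).
have hx : x \is 1.-homog by rewrite dhomogX; apply/eqP/mdeg1.
have hy : y \is 1.-homog by rewrite dhomogX; apply/eqP/mdeg1.
have nat0 n : (0 < n)%N -> n%:R != 0 :> {mpoly R[2]}.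
  by move=> n0; rewrite -mpolyC_nat mpolyC_eq0 pnatr_eq0 -lt0n.
have scal0 (n : nat) (z : {mpoly R[2]}) p :
    (0 < n)%N -> z != 0 -> (n%:R * z * p == 0) = (p == 0).
  by move=> n0 z0; rewrite !mulf_eq0 (negbTE (nat0 _ n0)) (negbTE z0).
have hom (n : nat) (z p : {mpoly R[2]}) :
    z \is 1.-homog -> p \is d.-homog -> n%:R * z * p \is d.+1.-homog.
  by move=> hz hp; rewrite -mulrA mulr_natl; apply/rpredMn/(dhomogM hz hp).
split; [exact: hom | by rewrite rpredN; exact: hom | | ].
  move=> w0; have /eqP := congr1 fst w0; rewrite /= opprK scal0 // => /eqP q0.
  have /eqP := congr1 snd w0; rewrite /= scal0 // => /eqP r0.
  by move: qr0; rewrite q0 r0 !raddf0 eqxx.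
rewrite /is_pullback; set w' := pullback_form _ _; pose c := s1%:R * s2%:R * (phi.1 * phi.2).
have c0 : c != 0.
  by apply: mulf_neq0; apply: mulf_neq0; rewrite ?nat0 ?expf_neq0.
have [E1 E2] : x * w'.1 = c * pullback_fun phi q /\ y * w'.2 = c * pullback_fun phi r.
  rewrite /w' !pullback_form_power_map opprK !rmorphM !rmorph_nat /=.
  rewrite /x /y pullback_fun_x pullback_fun_y -/phi /c.
  by rewrite !mulr_regroup (mulrC s2%:R) (mulrC phi.2).
apply: rational_multiple_of_cross => //.
  move=> w'0; move: E1 E2; rewrite w'0 /= !mulr0 => /esym/eqP E1 /esym/eqP E2.
  by move: E1 E2 qr0; rewrite !(mulf_eq0 c) (negbTE c0) /= => -> ->.
(* Multiplied by [x * y], the cross identity becomes [c] times [qVrU]. *)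
apply: (mulfI (mulf_neq0 x0 y0)); rewrite mulrACA E1 (mulrC x) [RHS]mulrACA E2.
by rewrite -[LHS]mulrA -[RHS]mulrA; congr (_ * _).
Qed.
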